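(* Let $n\ge 3$ be odd, let $0\le k\le n$ be an integer, and let $X=\binom{[n]}{k}$ be the set of $k$-element subsets of $[n]=\{1,\dots,n\}$, with the action of the dihedral group $I_2(n)$ induced by its natural action on $[n]$. Then the triple $$\left(X,\ \genfrac{\{}{\}}{0pt}{}{n}{k}_{s,t},\ I_2(n)\right)$$ exhibits dihedral sieving.
   Context: $I_2(n)=\langle r,s \mid r^n=s^2=e,\ rs=sr^{-1}\rangle$ is the dihedral group of order $2n$. Its natural action on $[n]$ is the one on the vertices of a regular $n$-gon labelled cyclically by $1,\dots,n$ ($r$ acts as $i\mapsto i+1$ and $s$ as $i\mapsto -i$ modulo $n$). $\operatorname{Rep}(I_2(n))$ is the representation ring: the ring generated by isomorphism classes $[U]$ of finite-dimensional complex representations, with $[U\oplus V]=[U]+[V]$ and $[U\otimes V]=[U][V]$. For $n$ odd it is generated as a ring by $z_1$ and $\det$ (hence by $z_1$ and $-\det$). Here $z_1$ is the 2-dimensional representation sending $r$ to the rotation by $2\pi/n$ and $s$ to a reflection matrix, and $\det$ is the 1-dimensional representation with $\det(r)=1$, $\det(s)=-1$. Dihedral sieving: for $n$ odd, a finite $I_2(n)$-set $X$ and a polynomial $P(s,t)\in\mathbb{Z}[s,t]$, the triple $(X,P(s,t),I_2(n))$ exhibits dihedral sieving if $\mathbb{C}[X]=P(z_1,-\det)$ in $\operatorname{Rep}(I_2(n))$, where $\mathbb{C}[X]$ is the permutation representation. (The polynomial variable $s$ is unrelated to the group element $s$.) Generalized Fibonacci polynomials: $\{0\}_{s,t}=0$,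 $\{1\}_{s,t}=1$, $\{m+2\}_{s,t}=s\{m+1\}_{s,t}+t\{m\}_{s,t}$. Put $\{m\}!_{s,t}=\{m\}_{s,t}\{m-1\}_{s,t}\cdots\{1\}_{s,t}$ (with $\{0\}!_{s,t}=1$). The Fibonomial coefficient is $\genfrac{\{}{\}}{0pt}{}{m}{k}_{s,t}=\dfrac{\{m\}!_{s,t}}{\{k\}!_{s,t}\{m-k\}!_{s,t}}$, which is known to be a polynomial in $s,t$ with nonnegative integer coefficients. *)

(* Defs.v *)
From HB Require Import structures.
From mathcomp Require Import all_boot all_order all_algebra all_fingroup.
From mathcomp Require Import all_solvable all_field all_character.
From mathcomp Require Import generic_quotient polyXY complex.
From mathcomp Require Import boolp reals trigo ring.

Set Implicit Arguments.
Unset Strict Implicit.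
Unset Printing Implicit Defensive.

Import Order.TTheory GRing.Theory Num.Theory.
Local Open Scope quotient_scope.
Local Open Scope ring_scope.

(* In characteristic 0 the trace determines a representation up to            *)
(* isomorphism.  character.v has this over algC only; its proof is adapted to *)
(* an arbitrary numClosedFieldType.  It serves below only to prove that the   *)
(* representation ring is a commutative ring.                                 *)

Section TraceDetermines.

Variables (C : numClosedFieldType) (gT : finGroupType) (G : {group gT}).

Let iG : irrType C G := DecSocleType _.

Lemma pchar'G_num : ([pchar C]^'.-group G)%g.
Proof. by apply/pgroupP => p _ _; rewrite inE /= pchar_num. Qed.

Section StdRepr.

Variables (n : nat) (rG : mx_representation C G n).
Let sG := DecSocleType rG.

Definition std_irr (W : sG) := irr_comp iG (socle_repr W).

Definition std_socle i := pick [pred W | std_irr W == i].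
Local Notation soc := std_socle.

Definition std_coef i := oapp (fun W => socle_mult W) 0%N (soc i).

Definition std_grepr : representation C G :=
  \big[dadd_grepr/grepr0]_i
     muln_grepr (Representation (socle_repr i)) (std_coef i).

Lemma mx_rsim_std : mx_rsim rG std_grepr.
Proof.
pose W i := oapp val 0 (soc i); pose S := (\sum_i W i)%MS.
have C'G := pchar'G_num.
have [defS dxS]: (S :=: 1%:M)%MS /\ mxdirect S.
  rewrite /S mxdirectE /= !(bigID soc xpredT) /=.
  rewrite addsmxC big1 => [|i]; last by rewrite /W; case (soc i).
  rewrite adds0mx_id addnC (@big1 nat) ?add0n => [|i]; last first.
    by rewrite /W; case: (soc i); rewrite ?mxrank0.
  have <-: Socle sG = 1%:M := reducible_Socle1 sG (mx_Maschke_pchar rG C'G).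
  have [W0 _ | noW] := pickP sG; last first.
    suff no_i: (soc : pred iG) =1 xpred0 by rewrite /Socle !big_pred0 ?mxrank0.
    by move=> i; rewrite /soc; case: pickP => // W0; have:= noW W0.
  have irrK Wi: soc (std_irr Wi) = Some Wi.
    rewrite /soc; case: pickP => [W' | /(_ Wi)] /= /eqP // eqWi.
    apply/eqP/socle_rsimP.
    apply: mx_rsim_trans
      (rsim_irr_comp_pchar iG C'G (socle_irr _)) (mx_rsim_sym _).
    by rewrite [irr_comp _ _]eqWi; apply: rsim_irr_comp_pchar (socle_irr _).
  have bij_irr: {on [pred i | soc i], bijective std_irr}.
    exists (odflt W0 \o soc) => [Wi _ | i]; first by rewrite /= irrK.
    by rewrite inE /soc /=; case: pickP => //= Wi; move/eqP.
  rewrite !(reindex std_irr) {bij_irr}//=.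
  have all_soc Wi: soc (std_irr Wi) by rewrite irrK.
  rewrite (eq_bigr val) => [|Wi _]; last by rewrite /W irrK.
  rewrite !(eq_bigl _ _ all_soc); split=> //.
  rewrite (eq_bigr (mxrank \o val)) => [|Wi _]; last by rewrite /W irrK.
  by rewrite -mxdirectE /= Socle_direct.
pose modW i : mxmodule rG (W i) :=
  if soc i is Some Wi as oWi return mxmodule rG (oapp val 0 oWi) then
    component_mx_module rG (socle_base Wi)
  else mxmodule0 rG n.
apply: mx_rsim_trans (mx_rsim_sym (rsim_submod1 (mxmodule1 rG) _)) _ => //.
apply: mx_rsim_dsum (modW) _ defS dxS _ => i.
rewrite /W /std_coef /modW /soc; case: pickP => [Wi|_] /=; last first.
  rewrite /muln_grepr big_ord0.
  by exists 0 => [||x _]; rewrite /row_free ?mxrank0 ?mulmx0 ?mul0mx.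
move/eqP=> <-; apply: mx_rsim_socle.
exact: rsim_irr_comp_pchar (socle_irr Wi).
Qed.

End StdRepr.

Lemma gring_op_trace n (rG : mx_representation C G n) A :
  \tr (gring_op rG A) = \sum_i gring_row A 0 i * \tr (rG (enum_val i)).
Proof.
rewrite gring_opE [in LHS](row_sum_delta (gring_row A)) !linear_sum /=.
by apply: eq_bigr => i _; rewrite !linearZ /= /gring_mx /= -rowE rowK mxvecK.
Qed.

Lemma gring_op_dadd (U V : representation C G) A :
  \tr (gring_op (dadd_grepr U V) A) = \tr (gring_op U A) + \tr (gring_op V A).
Proof.
rewrite !gring_op_trace -big_split; apply: eq_bigr => i _ /=.
by rewrite mxtrace_block mulrDr.
Qed.

Lemma gring_op_grepr0 A : \tr (gring_op (grepr0 : representation C G) A) = 0.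
Proof. by rewrite gring_op_trace big1 // => i _; rewrite mxtrace1 mulr0. Qed.

Lemma std_coef_trace n (rG : mx_representation C G n) i :
  \tr (gring_op (std_grepr rG) (Wedderburn_id i))
    = (std_coef rG i * irr_degree i)%:R.
Proof.
have tr_sum I r (F : I -> representation C G) A :
    \tr (gring_op (\big[dadd_grepr/grepr0]_(j <- r) F j) A)
      = \sum_(j <- r) \tr (gring_op (F j) A).
  by apply: (big_morph (fun U : representation C G => \tr (gring_op U A))) => [U V|];
     rewrite ?gring_op_dadd ?gring_op_grepr0.
rewrite /std_grepr tr_sum (bigD1 i) //= [X in _ + X]big1 => [|j neq_ji].
  rewrite addr0 /muln_grepr tr_sum sumr_const card_ord /=.
  by rewrite (op_Wedderburn_id_pchar pchar'G_num) mxtrace1 natrM mulr_natl.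
rewrite /muln_grepr tr_sum big1 // => k _ /=.
rewrite (@irr_repr'_op0_pchar _ _ _ iG pchar'G_num j i) ?mxtrace0 1?eq_sym //.
exact: Wedderburn_id_mem.
Qed.

Lemma mx_rsimP n1 n2 (rG1 : mx_representation C G n1)
    (rG2 : mx_representation C G n2) :
  mx_rsim rG1 rG2 <-> {in G, forall x, \tr (rG1 x) = \tr (rG2 x)}.
Proof.
split=> [|eq_tr]; first exact: mxtrace_rsim.
apply: mx_rsim_trans (mx_rsim_std _) (mx_rsim_trans _ (mx_rsim_sym (mx_rsim_std _))).
suffices eq_coef: std_coef rG1 =1 std_coef rG2.
  rewrite /std_grepr (eq_bigr (fun i : iG => muln_grepr
    (Representation (socle_repr i)) (std_coef rG2 i))) => [|i _].
    exact: mx_rsim_refl.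
  by rewrite eq_coef.
move=> i; apply/eqP; rewrite -(eqn_pmul2r (irr_degree_gt0 i)).
rewrite -(@eqr_nat C) -!std_coef_trace !gring_op_trace; apply/eqP.
apply: eq_bigr => j _; have Gj := enum_valP j.
by rewrite -(mxtrace_rsim (mx_rsim_std rG1)) // eq_tr //
  (mxtrace_rsim (mx_rsim_std rG2)).
Qed.

End TraceDetermines.

(* The representation ring is the Grothendieck ring: formal differences       *)
(* [U] - [V] of representations modulo stable isomorphism, with direct sum    *)
(* and tensor product as operations.                                          *)

Section Grepr.

Variables (C : fieldType) (gT : finGroupType) (G : {group gT}).

Definition tensor_grepr (U V : representation C G) : representation C G :=
  Representation (prod_repr U V).

Fact triv_mx_repr : mx_repr G (fun _ : gT => 1%:M : 'M[C]_1).
Proof. by split=> // g h _ _; rewrite mulmx1. Qed.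

Definition triv_grepr : representation C G :=
  Representation (MxRepresentation triv_mx_repr).

(* Pairs (U, V) standing for [U] - [V]. *)
Definition vrep : Type := (representation C G * representation C G)%type.

HB.instance Definition _ := gen_eqMixin vrep.
HB.instance Definition _ := gen_choiceMixin vrep.

Definition vrep_sim (u v : vrep) : Prop :=
  exists W : representation C G,
    mx_rsim (dadd_grepr (dadd_grepr u.1 v.2) W)
            (dadd_grepr (dadd_grepr v.1 u.2) W).

Definition vrep_eqb : rel vrep := fun u v => `[< vrep_sim u v >].

Definition vrep_of (U : representation C G) : vrep := (U, grepr0).
Definition vrep_add (u v : vrep) : vrep :=
  (dadd_grepr u.1 v.1, dadd_grepr u.2 v.2).
Definition vrep_opp (u : vrep) : vrep := (u.2, u.1).
Definition vrep_mul (u v : vrep) : vrep :=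
  (dadd_grepr (tensor_grepr u.1 v.1) (tensor_grepr u.2 v.2),
   dadd_grepr (tensor_grepr u.1 v.2) (tensor_grepr u.2 v.1)).

End Grepr.

Section RepRing.

Variables (C : numClosedFieldType) (gT : finGroupType) (G : {group gT}).

Local Notation vrep := (vrep C G).
Implicit Types (u v w : vrep) (U V : representation C G).

Definition vtrace u (x : gT) : C := \tr (u.1 x) - \tr (u.2 x).

Lemma vrep_simP u v : reflect {in G, vtrace u =1 vtrace v} (vrep_eqb u v).
Proof.
apply: (iffP (asboolP _)) => [[W /mx_rsimP simW] x Gx | eq_uv].
  move/eqP: (simW x Gx); rewrite !mxtrace_block (inj_eq (addIr _)).
  by rewrite /vtrace => /eqP eq_x; apply/eqP; rewrite subr_eq addrAC -eq_x addrK.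
exists grepr0; apply/mx_rsimP => x Gx; rewrite !mxtrace_block; congr (_ + _).
by have /eqP := eq_uv x Gx; rewrite /vtrace subr_eq addrAC eq_sym subr_eq => /eqP.
Qed.

Fact vrep_eqb_refl : reflexive (@vrep_eqb C gT G).
Proof. by move=> u; apply/vrep_simP. Qed.

Fact vrep_eqb_sym : symmetric (@vrep_eqb C gT G).
Proof.
by move=> u v; apply/vrep_simP/vrep_simP => eq_uv x Gx; rewrite eq_uv.
Qed.

Fact vrep_eqb_trans : transitive (@vrep_eqb C gT G).
Proof.
move=> v u w /vrep_simP eq_uv /vrep_simP eq_vw; apply/vrep_simP => x Gx.
by rewrite eq_uv ?eq_vw.
Qed.

Canonical vrep_equiv :=
  EquivRel (@vrep_eqb C gT G) vrep_eqb_refl vrep_eqb_sym vrep_eqb_trans.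

Definition Rep : Type := {eq_quot vrep_equiv}.
HB.instance Definition _ := Choice.on Rep.
HB.instance Definition _ := EqQuotient.on Rep.

Definition rep_class U : Rep := \pi_Rep (vrep_of U).

Definition Rep_add (a b : Rep) : Rep := \pi_Rep (vrep_add (repr a) (repr b)).
Definition Rep_opp (a : Rep) : Rep := \pi_Rep (vrep_opp (repr a)).
Definition Rep_mul (a b : Rep) : Rep := \pi_Rep (vrep_mul (repr a) (repr b)).

Definition Rep_trace (a : Rep) (x : gT) : C := vtrace (repr a) x.

Lemma Rep_eqP (a b : Rep) : a = b <-> {in G, Rep_trace a =1 Rep_trace b}.
Proof.
split=> [-> // | eq_ab]; rewrite -[a]reprK -[b]reprK.
by apply/eqmodP/vrep_simP.
Qed.

Lemma Rep_trace_pi u : {in G, Rep_trace (\pi_Rep u) =1 vtrace u}.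
Proof.
have /eqmodP/vrep_simP eq_u: repr (\pi_Rep u) = u %[mod Rep] by rewrite reprK.
exact: eq_u.
Qed.

Lemma Rep_traceD a b : {in G, forall x,
  Rep_trace (Rep_add a b) x = Rep_trace a x + Rep_trace b x}.
Proof.
by move=> x Gx; rewrite Rep_trace_pi // /Rep_trace /vtrace !mxtrace_block opprD addrACA.
Qed.

Lemma Rep_traceN a : {in G, forall x,
  Rep_trace (Rep_opp a) x = - Rep_trace a x}.
Proof. by move=> x Gx; rewrite Rep_trace_pi // /Rep_trace /vtrace opprB. Qed.

Lemma Rep_traceM a b : {in G, forall x,
  Rep_trace (Rep_mul a b) x = Rep_trace a x * Rep_trace b x}.
Proof.
move=> x Gx; rewrite Rep_trace_pi // /Rep_trace /vtrace !mxtrace_block !mxtrace_prod.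
by ring.
Qed.

Lemma Rep_trace_class U : {in G, forall x, Rep_trace (rep_class U) x = \tr (U x)}.
Proof. by move=> x Gx; rewrite Rep_trace_pi // /Rep_trace /vtrace mxtrace1 subr0. Qed.

Let RepE :=
  (Rep_traceD, Rep_traceN, Rep_traceM, Rep_trace_class, mxtrace1).

Fact Rep_addA : associative Rep_add.
Proof. by move=> a b c; apply/Rep_eqP => x Gx; rewrite !RepE // addrA. Qed.
Fact Rep_addC : commutative Rep_add.
Proof. by move=> a b; apply/Rep_eqP => x Gx; rewrite !RepE // addrC. Qed.
Fact Rep_add0 : left_id (rep_class grepr0) Rep_add.
Proof. by move=> a; apply/Rep_eqP => x Gx; rewrite !RepE // add0r. Qed.
Fact Rep_addN : left_inverse (rep_class grepr0) Rep_opp Rep_add.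
Proof. by move=> a; apply/Rep_eqP => x Gx; rewrite !RepE // addNr. Qed.

HB.instance Definition _ :=
  GRing.isZmodule.Build Rep Rep_addA Rep_addC Rep_add0 Rep_addN.

Fact Rep_mulA : associative Rep_mul.
Proof. by move=> a b c; apply/Rep_eqP => x Gx; rewrite !RepE // mulrA. Qed.
Fact Rep_mulC : commutative Rep_mul.
Proof. by move=> a b; apply/Rep_eqP => x Gx; rewrite !RepE // mulrC. Qed.
Fact Rep_mul1 : left_id (rep_class (triv_grepr C G)) Rep_mul.
Proof. by move=> a; apply/Rep_eqP => x Gx; rewrite !RepE // mul1r. Qed.
Fact Rep_mulD : left_distributive Rep_mul Rep_add.
Proof. by move=> a b c; apply/Rep_eqP => x Gx; rewrite !RepE // mulrDl. Qed.
Fact Rep_nontriv : rep_class (triv_grepr C G) != 0.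
Proof.
apply/eqP => /Rep_eqP/(_ _ (group1 G)); rewrite !RepE //.
by move/eqP; rewrite oner_eq0.
Qed.

HB.instance Definition _ := GRing.Zmodule_isComNzRing.Build Rep
  Rep_mulA Rep_mulC Rep_mul1 Rep_mulD Rep_nontriv.

Lemma rep_class_eq U V : rep_class U = rep_class V <-> mx_rsim U V.
Proof.
split=> [/Rep_eqP eqUV | /mx_rsimP eqUV].
  by apply/mx_rsimP => x Gx; rewrite -!Rep_trace_class ?eqUV.
by apply/Rep_eqP => x Gx; rewrite !RepE ?eqUV.
Qed.

Lemma rep_classD U V : rep_class (dadd_grepr U V) = rep_class U + rep_class V.
Proof. by apply/Rep_eqP => x Gx; rewrite !RepE // mxtrace_block. Qed.

Lemma rep_classM U V : rep_class (tensor_grepr U V) = rep_class U * rep_class V.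
Proof. by apply/Rep_eqP => x Gx; rewrite !RepE // mxtrace_prod. Qed.

Lemma rep_class1 : rep_class (triv_grepr C G) = 1.
Proof. by []. Qed.

Lemma rep_class_gen (a : Rep) : exists U V, a = rep_class U - rep_class V.
Proof.
exists (repr a).1, (repr a).2; apply/Rep_eqP => x Gx.
by rewrite Rep_traceD // Rep_traceN // !Rep_trace_class.
Qed.

End RepRing.

Section PermRepr.

Variables (C : fieldType) (gT : finGroupType) (X : finType).
Variable to : {action gT &-> X}.

(* Actions and matrix representations are both on the right in MathComp: the  *)
(* row vector of x is sent to the row vector of to x g.                       *)
Definition perm_act_mx (g : gT) : 'M[C]_#|X| :=
  \matrix_(i, j) (to (enum_val i) g == enum_val j)%:R.

Fact perm_act_mx_repr : mx_repr [set: gT]%G perm_act_mx.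
Proof.
split=> [|g h _ _]; apply/matrixP => i j; rewrite !mxE.
  by rewrite act1 (inj_eq enum_val_inj).
rewrite (bigD1 (enum_rank (to (enum_val i) g))) //= !mxE enum_rankK eqxx mul1r.
rewrite actM big1 ?addr0 // => k neq_k; rewrite !mxE.
have [eq_k | _] := eqVneq (to (enum_val i) g) (enum_val k); last by rewrite mul0r.
by rewrite eq_k enum_valK eqxx in neq_k.
Qed.

Definition perm_grepr : representation C [set: gT]%G :=
  Representation (MxRepresentation perm_act_mx_repr).

End PermRepr.

(* The pair (i, b) is r^i s^b.  As 'Z_n is the ring of integers mod n only    *)
(* for n > 1, so is dihedral n the dihedral group of order 2n.                *)
Definition dihedral (n : nat) : Type := ('Z_n * bool)%type.

Section Dihedral.

Variable n : nat.
Local Notation D := (dihedral n).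

HB.instance Definition _ := Finite.copy D ('Z_n * bool)%type.

Definition dih_one : D := (0, false).
Definition dih_mul (x y : D) : D := (x.1 + (-1) ^+ x.2 * y.1, x.2 (+) y.2).
Definition dih_inv (x : D) : D := (- ((-1) ^+ x.2 * x.1), x.2).

Fact dih_mulA : associative dih_mul.
Proof.
move=> [i a] [j b] [k c]; rewrite /dih_mul /= addbA signr_addb.
by rewrite mulrDr !addrA mulrA.
Qed.
Fact dih_mul1 : left_id dih_one dih_mul.
Proof. by case=> i a; rewrite /dih_mul /= expr0 mul1r add0r. Qed.
Fact dih_mulV : left_inverse dih_one dih_inv dih_mul.
Proof. by case=> i a; rewrite /dih_mul /= addNr addbb. Qed.

HB.instance Definition _ := Finite_isGroup.Build D dih_mulA dih_mul1 dih_mulV.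

Definition dih_r : D := (1, false).
Definition dih_s : D := (0, true).

Lemma dih_mulE (x y : D) : (x * y)%g = dih_mul x y. Proof. by []. Qed.

Lemma dih_rX k : (dih_r ^+ k)%g = (k%:R, false) :> D.
Proof.
elim: k => [//|k IHk]; rewrite expgS IHk dih_mulE /dih_mul /=.
by rewrite expr0 mul1r mulrS.
Qed.

Lemma dihE (x : D) : x = (dih_r ^+ x.1 * dih_s ^+ x.2)%g.
Proof.
case: x => i b; rewrite dih_rX dih_mulE /dih_mul /= natr_Zp.
by case: b; rewrite /= mulr0 addr0.
Qed.

Lemma card_dihedral_type : (1 < n)%N -> #|{: D}| = (2 * n)%N.
Proof. by move=> n_gt1; rewrite card_prod card_bool card_ord Zp_cast // mulnC. Qed.

Lemma dihedral_presentation : (1 < n)%N ->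
  ([set: D] \isog Grp (r : s : r ^+ n, s ^+ 2%N, r * s = s * r^-1))%g.
Proof.
move=> n_gt1; apply: intro_isoGrp => [|gT H].
  have rn : (dih_r ^+ n = 1)%g by rewrite dih_rX pchar_Zp.
  have s2 : (dih_s ^+ 2 = 1)%g by rewrite expg2 dih_mulE /dih_mul /= mulr0 addr0.
  have rs : (dih_r * dih_s = dih_s * dih_r^-1)%g.
    rewrite !dih_mulE /dih_mul /= !expr0 mul1r addr0 add0r.
    by rewrite expr1 mulN1r mul1r opprK.
  have gen : (<[dih_r]> <*> <[dih_s]> = [set: D])%g.
    apply/eqP; rewrite eqEsubset subsetT; apply/subsetP => x _; rewrite (dihE x).
    by rewrite groupM // groupX // mem_gen // inE cycle_id ?orbT.
  by apply/existsP; exists (dih_r, dih_s); apply/eqP; congr (_, (_, (_, _))).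
case/existsP => -[x y] /= /eqP[defH xn y2 xy].
pose f (g : D) := (x ^+ g.1 * y ^+ g.2)%g.
have xmod k : (x ^+ (k%:R : 'Z_n)%R = x ^+ k)%g.
  by rewrite val_Zp_nat // expg_mod.
have xD (i j : 'Z_n) : (x ^+ (i + j)%R = x ^+ i * x ^+ j)%g.
  by rewrite -[in LHS](natr_Zp i) -[in LHS](natr_Zp j) -natrD xmod expgD.
have xN (i : 'Z_n) : (x ^+ (- i)%R = x ^- i)%g.
  by apply/eqP; rewrite eq_sym eq_invg_mul -xD subrr.
have yx (k : nat) : (y * x ^+ k = x ^- k * y)%g.
  elim: k => [|k IHk]; first by rewrite invg1 mulg1 mul1g.
  rewrite expgSr mulgA IHk -mulgA invMg.
  have -> : (y * x = x^-1 * y)%g.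
    apply: (mulgI x); rewrite mulKVg mulgA xy -mulgA mulVg mulg1 //.
  by rewrite !mulgA -expgVn -expgSr -expgS.
have fE (i : 'Z_n) (b : bool) : f (i, b) = (x ^+ i * y ^+ b)%g by [].
have yb a b : (y ^+ (a (+) b) = y ^+ a * y ^+ b)%g.
  by case: a b => [] []; rewrite /= ?expg0 ?mul1g ?mulg1 // expg1 -expg2 y2.
have fM' g h : f (g * h)%g = (f g * f h)%g.
  rewrite dih_mulE; case: g h => [i a] [j b].
  rewrite /dih_mul !fE xD yb -!mulgA; congr (_ * _)%g; rewrite !mulgA.
  case: a; last by rewrite [nat_of_bool _]/= expr0 mul1r expg0 mulg1 mul1g.
  by rewrite expr1 mulN1r xN expg1 yx.
have fM : {in [set: D] &, {morph f : g h / (g * h)%g}} by move=> g h _ _.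
have fr : f dih_r = x by rewrite /dih_r fE mulg1; apply: xmod 1%N.
have fs : f dih_s = y by rewrite /dih_s fE mul1g expg1.
apply/homgP; exists (Morphism fM).
apply/eqP; rewrite -defH eqEsubset; apply/andP; split.
  apply/subsetP => _ /morphimP[g _ _ ->] /=.
  by rewrite groupM // groupX // mem_gen // inE cycle_id ?orbT.
rewrite join_subG !cycle_subG; apply/andP; split; apply/morphimP.
  by exists dih_r; rewrite ?inE //= fr.
by exists dih_s; rewrite ?inE //= fs.
Qed.

(* The vertices of the n-gon are labelled by 'Z_n; the generators act by      *)
(* r : i |-> i + 1 and s : i |-> - i.                                         *)
Definition dih_act (i : 'Z_n) (g : D) : 'Z_n := (-1) ^+ g.2 * (i + g.1).

Fact dih_act_is_action : is_action [set: D] dih_act.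
Proof.
split=> [g i j /(can_inj (signrMK _))/addIr // | i [j a] [k b] _ _].
rewrite /dih_act dih_mulE /dih_mul /= addrA signr_addb [_ * (-1) ^+ b]mulrC.
by rewrite -mulrA !mulrDr signrMK.
Qed.

Definition dihedral_action : {action D &-> 'Z_n} := Action dih_act_is_action.

Lemma dihedral_action_r i : dihedral_action i dih_r = i + 1.
Proof. by rewrite /= /dih_act expr0 mul1r. Qed.

Lemma dihedral_action_s i : dihedral_action i dih_s = - i.
Proof. by rewrite /= /dih_act expr1 mulN1r addr0. Qed.

Variable k : nat.

Definition ksubset : Type := {A : {set 'Z_n} | #|A| == k}.
HB.instance Definition _ := Finite.on ksubset.

Fact ksubset_act_subproof (A : ksubset) (g : D) :
  #|[set dihedral_action i g | i in val A]| == k.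
Proof. by rewrite card_imset ?(eqP (valP A)) //; apply: act_inj. Qed.

Definition ksubset_act (A : ksubset) (g : D) : ksubset :=
  Sub [set dihedral_action i g | i in val A] (ksubset_act_subproof A g).

Fact ksubset_act_is_action : is_action [set: D] ksubset_act.
Proof.
split=> [g A B /(congr1 val) eqAB | A g h _ _].
  by apply/val_inj/(imset_inj (act_inj dihedral_action g)).
apply: val_inj; rewrite /= -imset_comp; apply: eq_imset => i.
by rewrite -[dih_act i _]/(dihedral_action i _) actM.
Qed.

Definition ksubset_action : {action D &-> ksubset} :=
  Action ksubset_act_is_action.

End Dihedral.

Section DihedralRepr.

Variables (R : realType) (n : nat).

Local Notation C := (R[i]).
Local Notation D := (dihedral n).

Definition rot_mx (theta : R) : 'M[C]_2 :=
  \matrix_(i, j) (if i == j then cos theta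
                  else if i == 0 then - sin theta else sin theta)%:C%C.

Definition refl_mx : 'M[C]_2 :=
  \matrix_(i, j) (if i == j then (-1) ^+ (i != 0) else 0).

Definition z1_mx (g : D) : 'M[C]_2 :=
  rot_mx (2 * pi / n%:R) ^+ g.1 *m refl_mx ^+ g.2.

Lemma rot_mxD a b : rot_mx a *m rot_mx b = rot_mx (a + b).
Proof.
apply/matrixP => i j; rewrite !mxE !big_ord_recl big_ord0 !mxE cosD sinD addr0.
rewrite -!rmorphM -!rmorphD; congr (_%:C)%C.
by case: i j => [[|[|//]] ?] [[|[|//]] ?] /=; ring.
Qed.

Lemma rot_mx0 : rot_mx 0 = 1%:M.
Proof.
apply/matrixP => i j; rewrite !mxE cos0 sin0 oppr0 if_same.
by case: eqP.
Qed.

Lemma rot_mxX a k : rot_mx a ^+ k = rot_mx (a *+ k).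
Proof.
elim: k => [|k IHk]; first by rewrite expr0 mulr0n rot_mx0.
by rewrite exprS IHk mulrS -rot_mxD.
Qed.

Lemma refl_mx_sqr : refl_mx *m refl_mx = 1%:M.
Proof.
apply/matrixP => i j; rewrite !mxE !big_ord_recl big_ord0 !mxE addr0.
by case: i j => [[|[|//]] ?] [[|[|//]] ?] /=; ring.
Qed.

Lemma refl_rot_mx a : refl_mx *m rot_mx a = rot_mx (- a) *m refl_mx.
Proof.
apply/matrixP => i j; rewrite !mxE !big_ord_recl !big_ord0 !mxE cosN sinN opprK.
by case: i j => [[|[|//]] ?] [[|[|//]] ?] /=; rewrite ?rmorphN /=; ring.
Qed.

Lemma rot_mx_order : rot_mx (2 * pi / n%:R) ^+ (Zp_trunc n).+2 = 1.
Proof.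
have rot2pi : rot_mx (pi *+ 2) = 1 by rewrite -[RHS]rot_mx0; apply/matrixP => i j;
  rewrite !mxE cos2pi sin2pi cos0 sin0.
rewrite mulr_natl; case: n => [|[|m]] /=.
- by rewrite invr0 mulr0 rot_mx0 expr1n.
- by rewrite invr1 mulr1 rot2pi expr1n.
by rewrite rot_mxX -[(_ / _) *+ _]mulr_natr mulfVK ?pnatr_eq0 // rot2pi.
Qed.

Fact z1_mx_repr : mx_repr [set: D]%G z1_mx.
Proof.
set w := rot_mx (2 * pi / n%:R); have w1 : w ^+ (Zp_trunc n).+2 = 1 by apply: rot_mx_order.
have wmod k : w ^+ (k %% (Zp_trunc n).+2) = w ^+ k by rewrite expr_mod.
have wD (i j : 'Z_n) : w ^+ (i + j)%R = w ^+ i *m w ^+ j.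
  by rewrite /= wmod exprD.
have wN (i : 'Z_n) : refl_mx *m w ^+ i = w ^+ (- i)%R *m refl_mx.
  have wNK : w ^+ (- i)%R *m w ^+ i = 1 by rewrite -wD addNr.
  have -> : w ^+ (- i)%R = rot_mx (- (2 * pi / n%:R *+ i)).
    rewrite -[LHS]mulmx1 -rot_mx0 -(subrr (2 * pi / n%:R *+ i)) -rot_mxD.
    by rewrite mulmxA -rot_mxX -/w wNK mul1mx.
  by rewrite rot_mxX refl_rot_mx.
have zE (i : 'Z_n) (b : bool) : z1_mx (i, b) = w ^+ i *m refl_mx ^+ b by [].
have sb a b : refl_mx ^+ (a (+) b) = refl_mx ^+ a *m refl_mx ^+ b.
  by case: a b => [] []; rewrite /= ?mulmx1 ?mul1mx // refl_mx_sqr.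
split=> [|[i a] [j b] _ _]; first by rewrite zE mulmx1.
rewrite dih_mulE /dih_mul !zE wD sb -!mulmxA; congr (_ *m _); rewrite !mulmxA.
congr (_ *m _); case: a; last by rewrite [nat_of_bool _]/= expr0 mul1r mulmx1 mul1mx.
by rewrite [nat_of_bool _]/= !expr1 mulN1r wN.
Qed.

Definition z1 : representation C [set: D]%G :=
  Representation (MxRepresentation z1_mx_repr).

Lemma z1_r : z1 (dih_r n) = rot_mx (2 * pi / n%:R).
Proof. exact: mulmx1. Qed.

Lemma z1_s : z1 (dih_s n) = refl_mx.
Proof. exact: mul1mx. Qed.

Fact det_mx_repr : mx_repr [set: D]%G (fun g : D => ((-1) ^+ g.2)%:M : 'M[C]_1).
Proof.
split=> [//|[i a] [j b] _ _].
by rewrite dih_mulE /dih_mul /= signr_addb scalar_mxM.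
Qed.

Definition det_grepr : representation C [set: D]%G :=
  Representation (MxRepresentation det_mx_repr).

Lemma det_r : det_grepr (dih_r n) = 1%:M. Proof. by []. Qed.

Lemma det_s : det_grepr (dih_s n) = (-1)%:M. Proof. by []. Qed.

(* Z[s,t] is {poly {poly int}}, with s = 'X the outer and t = 'Y the inner    *)
(* variable.                                                                  *)
Definition eval_st (S : comNzRingType) (P : {poly {poly int}}) (a b : S) : S :=
  (map_poly (map_poly intr) P).[a, b].

Definition dihedral_sieving (X : finType) (to : {action D &-> X})
    (P : {poly {poly int}}) : Prop :=
  rep_class (perm_grepr C to)
    = eval_st P (rep_class z1) (- rep_class det_grepr).

End DihedralRepr.

Fixpoint fibpoly (m : nat) : {poly {poly int}} :=
  match m with
  | 0 => 0
  | 1 => 1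
  | (m'.+1 as m1).+1 => 'X * fibpoly m1 + 'Y * fibpoly m'
  end.

Definition fibfact (m : nat) : {poly {poly int}} :=
  \prod_(1 <= i < m.+1) fibpoly i.

(* The divisor is monic in s, so %/ is Euclidean division; by fibonomialK it  *)
(* is exact for k <= m.                                                       *)
Definition fibonomial (m k : nat) : {poly {poly int}} :=
  fibfact m %/ (fibfact k * fibfact (m - k)).

Lemma fibpolySS m : fibpoly m.+2 = 'X * fibpoly m.+1 + 'Y * fibpoly m.
Proof. by []. Qed.

Lemma fibpoly_monic_size m : fibpoly m.+1 \is monic /\ size (fibpoly m.+1) = m.+1.
Proof.
suff: (fibpoly m.+1 \is monic /\ size (fibpoly m.+1) = m.+1)
   /\ (size (fibpoly m) <= m)%N by case.
elim: m => [|m [[mon_m size_m] size_m']].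
  by rewrite /= size_poly0 monic1 size_poly1.
have sizeX : size ('X * fibpoly m.+1) = m.+2.
  by rewrite mulrC size_mulX ?monic_neq0 ?size_m.
have lt_size : (size (('Y : {poly {poly int}}) * fibpoly m)%R < m.+2)%N.
  by rewrite mul_polyC (leq_ltn_trans (size_scale_leq _ _)) // ltnS (leq_trans size_m').
split; last by rewrite size_m.
rewrite fibpolySS size_polyDl sizeX //; split=> //.
by rewrite monicE lead_coefDl ?sizeX // lead_coefM lead_coefX mul1r -monicE.
Qed.

Lemma fibfactS m : fibfact m.+1 = fibfact m * fibpoly m.+1.
Proof. by rewrite /fibfact big_nat_recr. Qed.

Lemma fibfact0 : fibfact 0 = 1.
Proof. by rewrite /fibfact big_geq. Qed.

Lemma fibfact_monic m : fibfact m \is monic.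
Proof.
elim: m => [|m IHm]; first by rewrite fibfact0 monic1.
by rewrite fibfactS monicMl // (fibpoly_monic_size m).1.
Qed.

Lemma fibpolyD a b :
  fibpoly (a + b.+1) = fibpoly a.+1 * fibpoly b.+1 + 'Y * fibpoly a * fibpoly b.
Proof.
suff: fibpoly (a + b.+1) = fibpoly a.+1 * fibpoly b.+1 + 'Y * fibpoly a * fibpoly b
   /\ fibpoly (a + b.+2) = fibpoly a.+1 * fibpoly b.+2 + 'Y * fibpoly a * fibpoly b.+1
  by case.
elim: b => [|b [IHb IHb1]].
  split; first by rewrite addn1 /= mulr1 mulr0 addr0.
  by rewrite addn2 !fibpolySS /=; ring.
split=> //; rewrite 2!addnS fibpolySS -!addnS IHb1 IHb !fibpolySS; ring.
Qed.

Lemma fibfact_dvd a b :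
  exists Q, fibfact (a + b) = Q * (fibfact a * fibfact b).
Proof.
elim: a b => [|a IHa] b; first by exists 1; rewrite fibfact0 !mul1r.
elim: b => [|b [Q1 IHb]]; first by exists 1; rewrite addn0 fibfact0 mulr1 mul1r.
have [Q2 IHa2] := IHa b.+1.
exists (Q1 * fibpoly a.+2 + Q2 * 'Y * fibpoly b).
have -> : (a.+1 + b.+1 = (a.+1 + b).+1)%N by rewrite addnS.
rewrite fibfactS -addnS fibpolyD mulrDr.
rewrite {1}IHb addSnnS IHa2 !fibfactS; ring.
Qed.

Lemma fibonomialK m k : (k <= m)%N ->
  fibonomial m k * (fibfact k * fibfact (m - k)) = fibfact m.
Proof.
move=> le_km; have [Q] := fibfact_dvd k (m - k); rewrite subnKC // => defQ.
have mon : fibfact k * fibfact (m - k) \is monic by rewrite rpredM ?fibfact_monic.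
by rewrite /fibonomial defQ Pdiv.IdomainMonic.mulpK.
Qed.

(* Main.v *)
From HB Require Import structures.
Require Import Defs.
From mathcomp Require Import all_boot all_order all_algebra all_fingroup.
From mathcomp Require Import complex reals trigo polyXY zify ring.
From mathcomp Require Import cyclic mxrepresentation character.

Set Implicit Arguments.
Unset Strict Implicit.
Unset Printing Implicit Defensive.
Import Order.TTheory GRing.Theory Num.Theory.
Local Open Scope ring_scope.

(** The character of a representation determines its class, so it is enough to
compare, for each group element g, the number of k-subsets of the n-gon fixed
by g with the value of the Fibonomial coefficient at s = tr z1(g) and
t = - det(g).  Taking traces at g is a ring morphism from the representation
ring to the complex numbers, which is what turns the identity in Rep into these
numerical identities.

Both numbers are governed by the order d of g.

On the algebraic side, the values f m of the Fibonacci polynomials at such a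
point (s, t) satisfy, for g nontrivial, f d = 0 and t * f (d - 1) = 1, while
f 1, .., f (d - 1) are nonzero.  For a rotation by the angle th this comes from
f m * sin th = sin (m * th); oddness of n, hence of d, ensures that sin (m * th)
vanishes only when d divides m.  For a reflection (s, t) = (0, 1) and d = 2, so
that the same conditions hold.  Under these conditions the Fibonomial
coefficients obey a Lucas theorem, fibonomial_lucas: writing G a b for the value
of the coefficient of index (a + b, a),
  G a b = 'C(a / d + b / d, a / d) * G (a mod d) (b mod d),
and G vanishes on residues that produce a carry (fibonomial_carry).  For the
identity, (s, t) = (2, -1), f m = m and G is the ordinary binomial coefficient.

On the combinatorial side, a set is fixed by g exactly when it is a union of
orbits of <g>.  If <g> acts freely on S, all orbits there have d elements, so S
has 'C(|S| / d, k / d) fixed k-subsets when d divides k and none otherwise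
(card_stable_subsets).  A rotation acts freely on all vertices.  A reflection of
an odd polygon acts freely outside a unique fixed vertex, whose membership in a
fixed k-subset is forced by the parity of k. *)

(** * Recursion for the Fibonomial coefficients *)

Lemma fibonomial_factK a b :
  fibonomial (a + b) a * (fibfact a * fibfact b) = fibfact (a + b).
Proof. by have := fibonomialK (leq_addr b a); rewrite addKn. Qed.

(** The Pascal rule of this triangle: split {a + b + 2} by the addition formula
fibpolyD and cancel the Fibonacci factorials.  Indexing by the two parts a and b
of the upper index, rather than by the upper index and a, makes the boundary
values hold without any inequality. *)
Lemma fibonomial_recr a b :
  fibonomial (a.+1 + b.+1) a.+1
    = fibpoly a.+2 * fibonomial (a.+1 + b) a.+1
      + 'Y * fibpoly b * fibonomial (a + b.+1) a.
Proof.
have mon : fibfact a.+1 * fibfact b.+1 \is monic by rewrite rpredM ?fibfact_monic.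
apply: (mulIf (monic_neq0 mon)); rewrite fibonomial_factK addSn fibfactS.
have -> : (a + b.+1).+1 = (b + a.+2)%N by lia.
rewrite fibpolyD [in LHS]mulrDr.
have E1 := fibonomial_factK a.+1 b; have E2 := fibonomial_factK a b.+1.
have E : (a.+1 + b = a + b.+1)%N by lia.
rewrite -{1}E -{1}E1 -E2 !fibfactS; ring.
Qed.

Lemma fibonomial0r b : fibonomial (0 + b) 0 = 1.
Proof.
apply: (mulIf (monic_neq0 (fibfact_monic b))).
by have := fibonomial_factK 0 b; rewrite fibfact0 !mul1r.
Qed.

Lemma fibonomial0l a : fibonomial (a + 0) a = 1.
Proof.
apply: (mulIf (monic_neq0 (fibfact_monic a))).
by have := fibonomial_factK a 0; rewrite fibfact0 mul1r mulr1 addn0.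
Qed.

(** * Evaluation at a point *)

Section EvalSt.
Variables (K : comNzRingType) (s t : K).
Local Notation ev P := (eval_st P s t).

Lemma eval_stD P Q : ev (P + Q) = ev P + ev Q.
Proof. by rewrite /eval_st rmorphD !hornerD. Qed.

Lemma eval_stM P Q : ev (P * Q) = ev P * ev Q.
Proof. by rewrite /eval_st rmorphM !hornerM. Qed.

Lemma eval_st0 : ev 0 = 0.
Proof. by rewrite /eval_st rmorph0 !horner0. Qed.

Lemma eval_st1 : ev 1 = 1.
Proof. by rewrite /eval_st rmorph1 !hornerC. Qed.

Lemma eval_stX : ev 'X = s.
Proof. by rewrite /eval_st map_polyX hornerX hornerC. Qed.

Lemma eval_stY : ev 'Y = t.
Proof. by rewrite /eval_st map_polyC hornerC /= map_polyX hornerX. Qed.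

Lemma eval_fibSS m : ev (fibpoly m.+2) = s * ev (fibpoly m.+1) + t * ev (fibpoly m).
Proof. by rewrite fibpolySS eval_stD !eval_stM eval_stX eval_stY. Qed.
End EvalSt.

Lemma eval_st_morph (K L : comNzRingType) (f : {rmorphism K -> L}) P s t :
  f (eval_st P s t) = eval_st P (f s) (f t).
Proof.
rewrite /eval_st -horner_map -horner_map /= map_polyC /= -map_poly_comp /=.
congr (_.[_].[_]); apply: eq_map_poly => p /=; rewrite -map_poly_comp /=.
by apply: eq_map_poly => x /=; rewrite rmorph_int.
Qed.

(** * A Lucas theorem for Fibonomial coefficients *)

Section Lucas.
Variables (K : idomainType) (s t : K) (d : nat).
Local Notation ev P := (eval_st P s t).
Local Notation f m := (ev (fibpoly m)).
Local Notation G a b := (ev (fibonomial (a + b) a)).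

(* These force f (d + 1) = 1, whence f has period d; the last one makes the
   Fibonacci factorials below d cancellable. *)
Hypotheses (d_gt1 : (1 < d)%N) (fd : f d = 0) (fdp : t * f d.-1 = 1).
Hypothesis f_neq0 : forall j, (0 < j < d)%N -> f j != 0.

Lemma fib_periodic q j : f (q * d + j) = f j.
Proof.
have f_add m : f (m + d) = f m.
  suff: f (m + d) = f m /\ f (m.+1 + d) = f m.+1 by case.
  elim: m => [|m [IH0 IH1]]; last first.
    by split=> //; rewrite !addSn !eval_fibSS -addSn IH1 IH0.
  rewrite add0n fd eval_st0; split => //.
  case: d d_gt1 fd fdp => [//|e] _ fe1 te; rewrite add1n eval_fibSS.
  by rewrite fe1 mulr0 add0r te eval_st1.
elim: q => [//|q IH]; have -> : (q.+1 * d + j = q * d + j + d)%N by lia.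
by rewrite f_add.
Qed.

Lemma fibfact_neq0 j : (j < d)%N -> ev (fibfact j) != 0.
Proof.
elim: j => [|j IH] ltjd; first by rewrite fibfact0 eval_st1 oner_eq0.
by rewrite fibfactS eval_stM mulf_neq0 ?IH ?f_neq0 // ltnW.
Qed.

Lemma fibfact_eq0 m : (d <= m)%N -> ev (fibfact m) = 0.
Proof.
elim: m => [|m IH]; first by rewrite leqn0 => /eqP d0; move: d_gt1; rewrite d0.
rewrite fibfactS eval_stM leq_eqVlt ltnS => /orP[/eqP <-|/IH ->].
  by rewrite fd mulr0.
by rewrite mul0r.
Qed.

(** The product G a b * {a}! * {b}! = {a + b}! contains the factor f d = 0, and
neither {a}! nor {b}! vanishes. *)
Lemma fibonomial_carry a b : (a < d)%N -> (b < d)%N -> (d <= a + b)%N -> G a b = 0.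
Proof.
move=> lta ltb le; have /(congr1 (fun P => ev P)) := fibonomial_factK a b.
rewrite !eval_stM (fibfact_eq0 le) => /eqP.
rewrite !mulf_eq0 (negbTE (fibfact_neq0 lta)) (negbTE (fibfact_neq0 ltb)).
by rewrite !orbF => /eqP.
Qed.

Lemma eval_fibonomial_rec a b :
  G a.+1 b.+1 = f a.+2 * G a.+1 b + t * f b * G a b.+1.
Proof. by rewrite fibonomial_recr eval_stD !eval_stM eval_stY. Qed.

Lemma eval_fibonomial0r b : G 0 b = 1.
Proof. by rewrite fibonomial0r eval_st1. Qed.

Lemma eval_fibonomial0l a : G a 0 = 1.
Proof. by rewrite fibonomial0l eval_st1. Qed.

(** Induction along the Pascal rule.  If neither last digit rolls over, the rule
acts on the last digits alone, by periodicity.  If exactly one of them does, the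
term where it is still d - 1 is a carry and vanishes, the other has coefficient
1.  If both roll over, both coefficients are 1 (the second one because
t * f (d - 1) = 1), and the rule is the ordinary one for binomials of the
leading digits. *)
Lemma fibonomial_lucas_digits a1 a0 b1 b0 : (a0 < d)%N -> (b0 < d)%N ->
  G (a1 * d + a0) (b1 * d + b0) = 'C(a1 + b1, a1)%:R * G a0 b0.
Proof.
move: {2}(_ + _)%N (leqnn ((a1 * d + a0) + (b1 * d + b0))) => N.
elim: N a1 a0 b1 b0 => [|N IH] a1 a0 b1 b0.
  rewrite leqn0 !addn_eq0 !muln_eq0 -!andbA => /and4P[a1_0 /eqP-> b1_0 /eqP->] _ _.
  have d0 : d == 0%N = false by lia.
  move: a1_0 b1_0; rewrite d0 !orbF => /eqP-> /eqP->.
  by rewrite !mul0n !add0n bin0 eval_fibonomial0r mulr1.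
move=> leN lta ltb.
have [a_0|a_gt0] := posnP (a1 * d + a0).
  have [-> ->] : a1 = 0%N /\ a0 = 0%N by nia.
  by rewrite mul0n !eval_fibonomial0r bin0 mulr1.
have [b_0|b_gt0] := posnP (b1 * d + b0).
  have [-> ->] : b1 = 0%N /\ b0 = 0%N by nia.
  by rewrite mul0n !eval_fibonomial0l addn0 binn mulr1.
case: a0 lta leN a_gt0 => [|a0] lta leN a_gt0;
  case: b0 ltb leN b_gt0 => [|b0] ltb leN b_gt0.
(* The four cases: a last digit is null when it has just rolled over. *)
- case: a1 a_gt0 leN => [//|a1] a_gt0 leN; case: b1 b_gt0 leN => [//|b1] b_gt0 leN.
  have Ea : (a1.+1 * d + 0 = (a1 * d + d.-1).+1)%N by nia.
  have Eb : (b1.+1 * d + 0 = (b1 * d + d.-1).+1)%N by nia.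
  rewrite Ea Eb eval_fibonomial_rec -Ea -Eb !IH; try lia.
  have -> : ((a1.+1 * d + 0).+1 = a1.+1 * d + 1)%N by lia.
  rewrite !fib_periodic fdp eval_st1 !eval_fibonomial0r !eval_fibonomial0l.
  rewrite !mulr1 !mul1r.
  by rewrite -natrD [in RHS]addSn binS addSnnS.
- case: a1 a_gt0 leN => [//|a1] a_gt0 leN.
  have Ea : (a1.+1 * d + 0 = (a1 * d + d.-1).+1)%N by nia.
  have Eb : (b1 * d + b0.+1 = (b1 * d + b0).+1)%N by lia.
  rewrite Ea Eb eval_fibonomial_rec -Ea -Eb !IH; try lia.
  have -> : ((a1.+1 * d + 0).+1 = a1.+1 * d + 1)%N by lia.
  rewrite !fib_periodic eval_st1 !eval_fibonomial0r (@fibonomial_carry d.-1); try lia.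
  by rewrite !mulr0 mul1r addr0.
- case: b1 b_gt0 leN => [//|b1] b_gt0 leN.
  have Eb : (b1.+1 * d + 0 = (b1 * d + d.-1).+1)%N by nia.
  have Ea : (a1 * d + a0.+1 = (a1 * d + a0).+1)%N by lia.
  rewrite Ea Eb eval_fibonomial_rec -Ea -Eb !IH; try lia.
  have -> : ((a1 * d + a0.+1).+1 = a1 * d + a0.+2)%N by lia.
  rewrite !fib_periodic fdp !eval_fibonomial0l (@fibonomial_carry _ d.-1); try lia.
  by rewrite !mulr0 add0r mul1r.
have Ea : (a1 * d + a0.+1 = (a1 * d + a0).+1)%N by lia.
have Eb : (b1 * d + b0.+1 = (b1 * d + b0).+1)%N by lia.
rewrite Ea Eb eval_fibonomial_rec -Ea -Eb !IH; try lia.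
have -> : ((a1 * d + a0.+1).+1 = a1 * d + a0.+2)%N by lia.
rewrite !fib_periodic eval_fibonomial_rec; ring.
Qed.

Lemma fibonomial_lucas a b :
  G a b = 'C(a %/ d + b %/ d, a %/ d)%:R * G (a %% d) (b %% d).
Proof. by rewrite -fibonomial_lucas_digits ?ltn_mod -?divn_eq //; lia. Qed.
End Lucas.

(** * Subsets stable under a freely acting cyclic group *)

Section Stable.
Local Open Scope group_scope.
Variables (aT : finGroupType) (T : finType) (to : {action aT &-> T}).
Variables (g : aT) (S : {set T}).
Local Notation orb := (orbit to <[g]>).
Hypothesis actsS : [acts <[g]>, on S | to].
Hypothesis freeS : {in S, forall x, 'C_<[g]>[x | to] = 1}%g.

Lemma stableP (A : {set T}) : reflect (to^* A g = A)%act [acts <[g]>, on A | to].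
Proof.
rewrite cycle_subG /= -astab1_set; apply: (iffP idP) => [/astab1P //|H].
by apply/astab1P.
Qed.

Lemma card_free_orbit x : x \in S -> #|orb x| = #[g].
Proof. by move=> Sx; rewrite card_orbit freeS // indexg1. Qed.

Lemma card_stable (A : {set T}) : A \subset S -> [acts <[g]>, on A | to] ->
  #|A| = (#|orb @: A| * #[g])%N.
Proof.
move=> sAS actsA; apply: card_uniform_partition (orbit_partition actsA).
by move=> _ /imsetP[x Ax ->]; rewrite card_free_orbit // (subsetP sAS).
Qed.

(** A stable subset A of S amounts to the set of its orbits, an arbitrary set of
orbits of S; by freeness A has #[g] times as many elements as orbits. *)
Lemma card_stable_subsets k :
  #|[set A : {set T} | [&& A \subset S, to^* A g == A & #|A| == k]]%act|
    = if (#[g] %| k)%N then 'C(#|S| %/ #[g], k %/ #[g]) else 0%N.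
Proof.
have stab A : (to^* A g == A)%act = [acts <[g]>, on A | to].
  by apply/eqP/stableP.
case: ifP => [/dvdnP[q ->]|ndvd]; last first.
  apply/eqP; rewrite cards_eq0; apply/set0Pn => -[A]; rewrite !inE stab.
  by case/and3P=> sAS actsA /eqP kA; rewrite -kA card_stable // dvdn_mull in ndvd.
rewrite (card_stable (subxx S)) // !mulnK // -cards_draws.
have coverK (A : {set T}) : [acts <[g]>, on A | to] -> cover (orb @: A) = A.
  by move=> actsA; apply: cover_partition (orbit_partition actsA).
rewrite -(@card_in_imset _ _ (fun A : {set T} => orb @: A)); last first.
  move=> A B; rewrite !inE !stab => /and3P[_ actsA _] /and3P[_ actsB _] eqAB.
  by rewrite -[A]coverK // eqAB coverK.
congr #|pred_of_set _|; apply/setP => Q; rewrite !inE; apply/imsetP/andP.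
  case=> A; rewrite inE stab => /and3P[sAS actsA kA] ->.
  by rewrite imsetS // -(eqn_pmul2r (order_gt0 g)) -card_stable.
case=> sQ cardQ; have memQ x : x \in S -> (x \in cover Q) = (orb x \in Q).
  move=> Sx; apply/bigcupP/idP => [[B QB Bx]|Qx]; last first.
    by exists (orb x); rewrite ?orbit_refl.
  have /imsetP[y Sy defB] := subsetP sQ B QB.
  by move: QB Bx; rewrite defB => Qy /orbit_eqP ->.
have sQS : cover Q \subset S.
  rewrite -(coverK _ actsS); apply/subsetP => x /bigcupP[B QB Bx].
  by apply/bigcupP; exists B => //; apply: (subsetP sQ).
have actsQ : [acts <[g]>, on cover Q | to].
  apply/actsP => a Ga x; have [Sx|nSx] := boolP (x \in S).
    rewrite !memQ ?(acts_act actsS) //; congr (_ \in Q).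
    by apply/orbit_eqP; rewrite mem_orbit.
  rewrite !(contraNF (subsetP sQS _)) ?(acts_act actsS) //.
have defQ : Q = orb @: cover Q.
  apply/setP => B; apply/idP/imsetP => [QB|[x Qx ->]].
    have /imsetP[x Sx defB] := subsetP sQ B QB.
    by exists x; rewrite // memQ // -defB.
  by rewrite -memQ // (subsetP sQS).
exists (cover Q) => //; rewrite inE stab actsQ sQS /=.
by rewrite (card_stable sQS actsQ) -defQ (eqP cardQ).
Qed.
End Stable.

(** * The trace at a group element as a ring morphism *)

Section RepTrace.
Variables (C : numClosedFieldType) (gT : finGroupType) (G : {group gT}).
Variables (x : gT) (Gx : x \in G).

(** The membership proof is an argument because Rep_trace is additive and
multiplicative only on G; it lets the morphism structures be attached to this
constant. *)
Definition Rep_trace_at of x \in G := fun a : Rep C G => Rep_trace a x.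

Local Notation tr := (Rep_trace_at Gx).

Fact Rep_trace_at_zmod : zmod_morphism tr.
Proof. by move=> a b; rewrite /Rep_trace_at Rep_traceD // Rep_traceN. Qed.

Fact Rep_trace_at_monoid : monoid_morphism tr.
Proof.
split=> [|a b]; last by rewrite /Rep_trace_at Rep_traceM.
by rewrite /Rep_trace_at -rep_class1 Rep_trace_class // mxtrace1.
Qed.

HB.instance Definition _ :=
  GRing.isZmodMorphism.Build (Rep C G) C tr Rep_trace_at_zmod.
HB.instance Definition _ :=
  GRing.isMonoidMorphism.Build (Rep C G) C tr Rep_trace_at_monoid.

Lemma Rep_trace_eval_st P (a b : Rep C G) :
  Rep_trace (eval_st P a b) x = eval_st P (Rep_trace a x) (Rep_trace b x).
Proof. exact: (eval_st_morph tr). Qed.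
End RepTrace.

Lemma perm_grepr_trace (C : fieldType) (gT : finGroupType) (X : finType)
    (to : {action gT &-> X}) (g : gT) :
  \tr (perm_grepr C to g) = #|[set x | to x g == x]|%:R.
Proof.
rewrite /mxtrace (reindex (@enum_rank X)) /=; last exact: onW_bij (enum_rank_bij X).
rewrite -[in RHS]sum1_card natr_sum [RHS]big_mkcond /=.
by apply: eq_bigr => x _; rewrite mxE !enum_rankK inE; case: ifP.
Qed.

(** * Fixed k-subsets of the n-gon *)

Section Counting.
Variables (n k : nat).
Hypothesis n_gt1 : (1 < n)%N.
Local Notation D := (dihedral n).
Implicit Types (i : 'Z_n) (g : D).

Definition stable_ksubsets g : {set {set 'Z_n}} :=
  [set A : {set 'Z_n} | (setact (dihedral_action n) A g == A) && (#|A| == k)].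

Lemma card_Fix_ksubset g :
  #|[set A | ksubset_action n k A g == A]| = #|stable_ksubsets g|.
Proof.
rewrite -(card_imset _ val_inj); congr #|pred_of_set _|; apply/setP => A.
rewrite inE; apply/imsetP/andP => [[B]|[stabA cardA]].
  by rewrite inE => /eqP fixB ->; rewrite (valP B) -{2}fixB.
by exists (Sub A cardA); rewrite ?inE ?SubK // -val_eqE /= SubK.
Qed.

Lemma card_Zn : #|'Z_n| = n. Proof. by rewrite card_ord Zp_cast. Qed.

Lemma rotX i m : (((i, false) : D) ^+ m)%g = (i *+ m, false) :> D.
Proof.
elim: m => [//|m IH]; rewrite expgS IH dih_mulE /dih_mul /=.
by rewrite expr0 mul1r mulrS.
Qed.

Lemma order_rot_dvd i m : (#[(i, false) : D]%g %| m)%N = (n %| i * m)%N.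
Proof.
rewrite order_dvdn rotX xpair_eqE eqxx andbT -[i in i *+ _]natr_Zp -mulrnA.
by rewrite -val_eqE /= val_Zp_nat.
Qed.

Lemma rot_free i x : 'C_<[(i, false) : D]>[x | dihedral_action n]%g = 1%g.
Proof.
apply/trivgP/subsetP => h /setIP[/cycleP[m ->]].
rewrite rotX => /astab1P /= ; rewrite /dih_act /= expr0 mul1r => /eqP.
by rewrite addrC -subr_eq0 addrK => /eqP ->; rewrite inE.
Qed.

Lemma order_rot_dvdn i : (#[(i, false) : D]%g %| n)%N.
Proof. by rewrite order_rot_dvd dvdn_mull. Qed.

Lemma card_stable_rot i (d := #[(i, false) : D]%g) :
  #|stable_ksubsets (i, false)|
    = if (d %| k)%N then 'C(n %/ d, k %/ d) else 0%N.
Proof.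
have actsT : [acts <[(i, false) : D]>, on [set: 'Z_n] | dihedral_action n]%g.
  by apply/actsP => a _ x; rewrite !inE.
have freeT : {in [set: 'Z_n], forall x,
    'C_<[(i, false) : D]>[x | dihedral_action n] = 1}%g.
  by move=> x _; apply: rot_free.
have := card_stable_subsets actsT freeT k; rewrite cardsT card_Zn => <-.
by apply: eq_card => A; rewrite !inE subsetT.
Qed.

Lemma reflX2 i : (((i, true) : D) ^+ 2)%g = 1%g :> D.
Proof. by rewrite expg2 dih_mulE /dih_mul /= expr1 mulN1r subrr. Qed.

Lemma order_refl i : #[(i, true) : D]%g = 2%N.
Proof. by apply: (@nt_prime_order _ 2) (reflX2 i) _; rewrite ?xpair_eqE ?andbF. Qed.

(** A fixed vertex solves 2x = -i, and 2 is invertible modulo the odd n, with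
inverse h = (n + 1)/2. *)
Lemma refl_fixpoint i : odd n ->
  exists x0, forall x, (dihedral_action n x (i, true) == x) = (x == x0).
Proof.
move=> n_odd; pose h : 'Z_n := (n.+1)./2%:R.
have h2 : 2%:R * h = 1.
  rewrite -natrM mul2n -[_.*2]add0n.
  have -> : (0 + n.+1./2.*2 = n + 1)%N by lia.
  by rewrite natrD pchar_Zp // add0r.
exists (- (i * h)) => x; rewrite /= /dih_act /= expr1 mulN1r.
apply/eqP/eqP => [fixx|->].
  have : 2%:R * x = - i by rewrite mulr_natl mulr2n -{1}fixx opprD; ring.
  by move/(congr1 (fun y => h * y)); rewrite mulrA [h * _]mulrC h2 mul1r => ->; ring.
have ih : i = i * h + i * h by rewrite -mulr2n -mulr_natl mulrCA h2 mulr1.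
by rewrite [X in - (_ + X)]ih; ring.
Qed.

(** Removing the fixed vertex x0 is a bijection from the stable k-subsets onto the
stable subsets of the complement with 2 * (k / 2) elements. *)
Lemma card_stable_refl i : odd n ->
  #|stable_ksubsets (i, true)| = 'C(n %/ 2, k %/ 2)%N.
Proof.
move=> n_odd; have [x0 fix0] := refl_fixpoint i n_odd.
pose g : D := (i, true); pose S := ~: [set x0].
have acts0 A : [acts <[g]>, on A | dihedral_action n]%g =
    (setact (dihedral_action n) A g == A).
  by apply/idP/eqP => /stableP.
have acts1 (A B : {set 'Z_n}) : [acts <[g]>, on A | dihedral_action n]%g ->
   [acts <[g]>, on B | dihedral_action n]%g ->
   [acts <[g]>, on A :\: B | dihedral_action n]%g.
  move=> aA aB; apply/actsP => a Ga x.
  by rewrite !inE (acts_act aA) // (acts_act aB).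
have actsx0 : [acts <[g]>, on [set x0] | dihedral_action n]%g.
  have /eqP fx0 : dihedral_action n x0 g == x0 by rewrite fix0.
  by rewrite acts0 /setact imset_set1 fx0.
have actsT : [acts <[g]>, on [set: 'Z_n] | dihedral_action n]%g.
  by apply/actsP => a _ x; rewrite !inE.
have actsS : [acts <[g]>, on S | dihedral_action n]%g.
  by rewrite /S -setTD; apply: acts1.
have freeS : {in S, forall x, 'C_<[g]>[x | dihedral_action n] = 1}%g.
  move=> x; rewrite !inE => neqx; apply/trivgP/subsetP => h /setIP[].
  rewrite /= cycle2g ?order_refl // => /set2P[-> _|->]; first by rewrite inE.
  move=> /astab1P fixx.
  by move: neqx; rewrite -fix0 fixx eqxx.
have cardS : #|S| = (n %/ 2 * 2)%N.
  by rewrite cardsC1 card_Zn; lia.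
have := card_stable_subsets actsS freeS (k %/ 2 * 2)%N.
rewrite order_refl dvdn_mull // cardS !mulnK // => <-.
(* A :\ x0 is a union of pairs, so parity decides whether x0 is in A. *)
have odd_stable A : A \in stable_ksubsets g -> (x0 \in A) = odd k.
  rewrite inE -acts0 => /andP[actsA /eqP cardA].
  have sDS : A :\ x0 \subset S by apply/subsetP => x; rewrite !inE => /andP[].
  have := card_stable freeS sDS (acts1 _ _ actsA actsx0).
  rewrite order_refl => cD; have := cardsD1 x0 A; rewrite cD cardA => ->.
  by rewrite oddD oddM andbF addbF oddb.
rewrite -(@card_in_imset _ _ (fun A : {set 'Z_n} => A :\ x0)); last first.
  move=> A B sA sB eqAB; apply/setP => x; have [->|neqx] := eqVneq x x0.
    by rewrite !odd_stable.
  by have := congr1 (fun E : {set 'Z_n} => x \in E) eqAB; rewrite !inE neqx.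
congr #|pred_of_set _|; apply/setP => B; apply/imsetP/idP => [[A sA ->]|].
  have oA := odd_stable A sA; move: sA.
  rewrite !inE -!acts0 => /andP[actsA /eqP cardA].
  apply/and3P; split; [|exact: acts1|].
    by apply/subsetP => x; rewrite !inE => /andP[].
  have -> : (k %/ 2 * 2 = k - odd k)%N by lia.
  by rewrite -[X in (X - _)%N]cardA (cardsD1 x0 A) oA addKn.
rewrite inE -acts0 => /and3P[sBS actsB /eqP cardB].
have nBx0 : x0 \notin B by apply: contraTN isT => /(subsetP sBS); rewrite !inE eqxx.
case ok: (odd k); last first.
  exists B; last first.
    by apply/setP => x; rewrite !inE; case: eqVneq => // ->; apply/negbTE.
  by rewrite inE -acts0 actsB cardB; lia.
exists (x0 |: B); last by rewrite setU1K.
rewrite inE -acts0 cardsU1 nBx0 cardB andbC; apply/andP; split; first by lia.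
apply/actsP => a Ga x.
by rewrite !in_setU (acts_act actsB) // (acts_act actsx0).
Qed.
End Counting.

(** * Values of Fibonacci and Fibonomial polynomials *)

Section Trig.
Variable R : realType.
Local Notation C := R[i].

Lemma sinD2pin (x : R) m : sin (x + pi *+ 2 *+ m) = sin x.
Proof.
by elim: m => [|m IH]; rewrite ?mulr0n ?addr0 // mulrSr addrA sinD2pi.
Qed.

(** Reducing m modulo n changes the sine by a sign only, and a nonzero remainder
gives an angle strictly between 0 and pi. *)
Lemma sin_natpi_eq0 n m : (0 < n)%N ->
  sin (pi * m%:R / n%:R : R) = 0 -> (n %| m)%N.
Proof.
move=> n_gt0; have n0 : n%:R != 0 :> R by rewrite pnatr_eq0 -lt0n.
rewrite {1}(divn_eq m n) natrD natrM mulrDr mulrDl mulrA mulfK //.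
have sinq q (x : R) : (sin (pi * q%:R + x) == 0) = (sin x == 0).
  elim: q => [|q IH]; first by rewrite mulr0 add0r.
  by rewrite mulrSr mulrDr mulr1 addrAC sinDpi oppr_eq0.
move=> /eqP; rewrite sinq; case: (posnP (m %% n)) => [|r_gt0 /eqP sr0].
  by move=> /eqP.
have : 0 < sin (pi * (m %% n)%:R / n%:R : R).
  apply: sin_gt0_pi; rewrite divr_gt0 ?mulr_gt0 ?pi_gt0 ?ltr0n //=.
  by rewrite ltr_pdivrMr ?ltr0n // ltr_pM2l ?pi_gt0 // ltr_nat ltn_mod.
by rewrite sr0 ltxx.
Qed.

(** At (s, t) = (2 cos th, -1) the recursion is that of the Chebyshev polynomials
of the second kind: sin ((m + 2) th) = 2 cos th sin ((m + 1) th) - sin (m th). *)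
Lemma fib_sin (th : R) m :
  eval_st (fibpoly m) (cos th *+ 2)%:C%C (-1) * (sin th)%:C%C
    = (sin (m%:R * th))%:C%C.
Proof.
pose P j := eval_st (fibpoly j) (cos th *+ 2)%:C%C (-1) * (sin th)%:C%C
  = (sin (j%:R * th))%:C%C.
suff: P m /\ P m.+1 by case.
elim: m => [|m [IH0 IH1]].
  by rewrite /P eval_st0 eval_st1 mul0r !mul1r mul0r sin0.
split=> //; rewrite /P eval_fibSS mulrDl -!mulrA IH0 IH1 mulN1r -rmorphM -rmorphB.
congr (_%:C)%C; rewrite /=.
have -> : m.+2%:R * th = m.+1%:R * th + th by rewrite -addn1 natrD mulrDl mul1r.
have -> : m%:R * th = m.+1%:R * th - th by rewrite -addn1 natrD mulrDl mul1r addrK.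
rewrite !sinD sinN cosN; ring.
Qed.
End Trig.

Lemma fib_nat (K : comNzRingType) m : eval_st (fibpoly m) (2%:R : K) (-1) = m%:R.
Proof.
suff: eval_st (fibpoly m) (2%:R : K) (-1) = m%:R
   /\ eval_st (fibpoly m.+1) (2%:R : K) (-1) = m.+1%:R by case.
elim: m => [|m [IH0 IH1]]; first by rewrite eval_st0 eval_st1.
by split=> //; rewrite eval_fibSS IH0 IH1; ring.
Qed.

(** With f m = m the Pascal rule reads
  G (a+1) (b+1) = (a + 2) * G (a+1) b - b * G a (b+1),
which binomials satisfy by the absorption identity
(a+1) * 'C(N, a+1) = (b+1) * 'C(N, a), where N = a + b + 1. *)
Lemma fibonomial_binomial (K : comNzRingType) a b :
  eval_st (fibonomial (a + b) a) (2%:R : K) (-1) = 'C(a + b, a)%:R.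
Proof.
move: {2}(a + b)%N (leqnn (a + b)) => N.
elim: N a b => [|N IH] [|a] [|b] le //;
  rewrite ?fibonomial0r ?fibonomial0l ?eval_st1 ?addn0 ?bin0 ?binn //.
rewrite fibonomial_recr eval_stD !eval_stM eval_stY !fib_nat !IH; try lia.
have /(congr1 (fun m => m%:R : K)) := mul_bin_left (a + b.+1) a.
have -> : (a + b.+1 - a = b.+1)%N by lia.
have -> : 'C(a.+1 + b.+1, a.+1) = ('C(a + b.+1, a.+1) + 'C(a + b.+1, a))%N by [].
rewrite !natrM addSnnS !natrD => H.
rewrite -[a.+2]addn1 natrD mulrDl H mul1r -[b.+1]addn1 natrD; ring.
Qed.

Section Eval.
Variables (R : realType) (n : nat).
Local Notation C := R[i].
Local Notation D := (dihedral n).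

Lemma z1_trace_rot (i : 'Z_n) :
  \tr (z1 R n (i, false)) = (cos (2 * pi / n%:R *+ i) *+ 2)%:C%C.
Proof.
rewrite /z1 /= /z1_mx /= mulmx1 rot_mxX /mxtrace !big_ord_recl big_ord0 !mxE /=.
by rewrite addr0 mulr2n rmorphD.
Qed.

Lemma z1_trace_refl (i : 'Z_n) : \tr (z1 R n (i, true)) = 0.
Proof.
rewrite /z1 /= /z1_mx /= rot_mxX /mxtrace !big_ord_recl big_ord0 !mxE.
by rewrite !big_ord_recl !big_ord0 !mxE /=; ring.
Qed.

(** With s = 0 and t = 1 the Fibonacci values alternate 0, 1, 0, 1, .., so the
Lucas theorem applies with d = 2; as a + b is odd, exactly one of a, b is odd and
there is no carry. *)
Lemma fibonomial_refl a b : odd (a + b) ->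
  eval_st (fibonomial (a + b) a) (0 : C) 1 = 'C((a + b) %/ 2, a %/ 2)%:R.
Proof.
move=> odd_ab.
rewrite (@fibonomial_lucas _ _ _ 2) //.
- have [[-> ->]|[-> ->]] :
      (a %% 2 = 0 /\ b %% 2 = 1 \/ a %% 2 = 1 /\ b %% 2 = 0)%N by lia.
    by rewrite fibonomial0r eval_st1 mulr1; congr ('C(_, _)%:R); lia.
  by rewrite fibonomial0l eval_st1 mulr1; congr ('C(_, _)%:R); lia.
- by rewrite eval_fibSS mul0r add0r eval_st0 mulr0.
- by rewrite eval_st1 mulr1.
by case=> [|[|j]] // _; rewrite eval_st1 oner_eq0.
Qed.

(** The order of the rotation plays the role of d in the Lucas theorem, except
for the identity, where sin th = 0 and the value is a plain binomial.  If d does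
not divide a, then a and b have residues adding up to d, which is a carry. *)
Lemma fibonomial_rot (i : 'Z_n) a b (d := #[(i, false) : D]%g) :
    (1 < n)%N -> odd n -> (a + b = n)%N ->
  eval_st (fibonomial (a + b) a) (cos (2 * pi / n%:R *+ i) *+ 2)%:C%C (-1 : C)
    = (if (d %| a)%N then 'C(n %/ d, a %/ d) else 0%N)%:R.
Proof.
move=> n_gt1 n_odd def_n; set th := _ *+ i.
have d_n : (d %| n)%N by apply: order_rot_dvdn.
have n0 : n%:R != 0 :> R by rewrite pnatr_eq0; lia.
have thE m : m%:R * th = pi * (2 * (i * m))%:R / n%:R.
  by rewrite /th !natrM -[_ *+ i]mulr_natl; field.
(* The angle is twice pi * (i * m) / n; the factor 2 is harmless as n is odd. *)
have sin_dvd m : sin (m%:R * th) = 0 -> (d %| m)%N.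
  rewrite thE => /sin_natpi_eq0 -/(_ (ltnW n_gt1)).
  by rewrite Gauss_dvdr ?coprimen2 // /d order_rot_dvd.
have dth : d%:R * th = pi *+ 2 *+ (i * d %/ n).
  have ndvd : (n %| i * d)%N by rewrite -order_rot_dvd.
  by rewrite thE -{1}(divnK ndvd) -[RHS]mulr_natl -[pi *+ 2]mulr_natl !natrM; field.
have sindth : sin (d%:R * th) = 0 by rewrite dth -[_ *+ _]add0r sinD2pin sin0.
have d_gt0 : (0 < d)%N by apply: order_gt0.
have [d1|d_neq1] := eqVneq d 1%N.
  have i0 : i = 0.
    have : (d %| 1)%N by rewrite d1.
    rewrite order_rot_dvd // muln1 => /dvdnP[q iq].
    apply/val_inj => /=; have := ltn_ord i; rewrite [X in (_ < X)%N]Zp_cast // iq.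
    case: q {iq} => //= q; lia.
  rewrite d1 dvd1n !divn1 /th i0 mulr0n cos0 rmorphMn /= fibonomial_binomial.
  by rewrite def_n.
have d_gt1 : (1 < d)%N by lia.
have sinth : (sin th)%:C%C != 0 :> C.
  rewrite fmorph_eq0; apply/eqP => th0; have := sin_dvd 1%N; rewrite mul1r => /(_ th0).
  by rewrite dvdn1 (negbTE d_neq1).
have fd : eval_st (fibpoly d) (cos th *+ 2)%:C%C (-1 : C) = 0.
  by apply: (mulIf sinth); rewrite fib_sin sindth mul0r.
have fdp : -1 * eval_st (fibpoly d.-1) (cos th *+ 2)%:C%C (-1 : C) = 1.
  apply: (mulIf sinth); rewrite -mulrA fib_sin mul1r mulN1r -rmorphN /=.
  congr (_%:C)%C; have -> : d.-1%:R * th = - th + d%:R * th.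
    by rewrite -{2}(prednK d_gt0) -[d.-1.+1]addn1 natrD; ring.
  by rewrite dth sinD2pin sinN opprK.
have f_neq0 j : (0 < j < d)%N ->
    eval_st (fibpoly j) (cos th *+ 2)%:C%C (-1 : C) != 0.
  move=> /andP[j_gt0 ltjd]; apply: contraTneq ltjd => fj0.
  rewrite -leqNgt dvdn_leq // sin_dvd //; apply/eqP.
  by rewrite -(fmorph_eq0 (real_complex R)) /= -fib_sin fj0 mul0r.
rewrite (fibonomial_lucas d_gt1 fd fdp f_neq0).
case: ifP => [d_a|nd_a].
  have d_b : (d %| b)%N by rewrite -(dvdn_addr _ d_a) def_n.
  rewrite (eqP d_a) (eqP d_b) fibonomial0r eval_st1 mulr1.
  by rewrite -divnDl // def_n.
rewrite (fibonomial_carry d_gt1 fd f_neq0) ?ltn_mod ?mulr0 //.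
rewrite dvdn_leq ?addn_gt0 ?lt0n -?/(dvdn d a) ?nd_a //.
by rewrite /dvdn modnDm def_n.
Qed.
End Eval.

(** * Dihedral sieving for k-subsets *)

Theorem proposition4p11 (R : realType) (n k : nat) (n_ge3 : (3 <= n)%N)
    (n_odd : odd n) (k_le_n : (k <= n)%N) :
  dihedral_sieving R (ksubset_action n k) (fibonomial n k).
Proof.
have n_gt1 : (1 < n)%N by apply: leq_trans n_ge3.
apply/Rep_eqP => g Gg; rewrite Rep_trace_class // perm_grepr_trace card_Fix_ksubset.
rewrite Rep_trace_eval_st // Rep_traceN // !Rep_trace_class //.
have -> : fibonomial n k = fibonomial (k + (n - k)) k by rewrite subnKC.
case: g {Gg} => i [].
  rewrite card_stable_refl // z1_trace_refl.
  by rewrite /= mxtrace_scalar expr1 opprK fibonomial_refl subnKC.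
rewrite card_stable_rot // z1_trace_rot [det_grepr _ _ _]/= mxtrace_scalar expr0.
by rewrite fibonomial_rot ?subnKC.
Qed.
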